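(* Let $R$ be a commutative principal ideal domain and $M$ a finitely generated $R$-module. Then $M$ is weakly uniserial if and only if $M \cong R^{n}$ or $M \cong \bigoplus_{n} (R/pR)$ (the direct sum of $n$ copies of $R/pR$) or $M \cong R/p^{n}R$, for some prime element $p$ of $R$ and some integer $n \geq 0$.
   Context: A module $M$ is called weakly uniserial if for any two submodules $N$ and $K$ of $M$ there exists an injective module homomorphism $N\to K$ or an injective module homomorphism $K\to N$. Prime elements are nonzero nonunits by definition; the case $M\cong R^n$ does not require a prime $p$ to exist. *)

(* Defs.v *)
From HB Require Import structures.
From mathcomp Require Import all_boot all_algebra.
From mathcomp Require Import boolp.

Set Implicit Arguments.
Unset Strict Implicit.
Unset Printing Implicit Defensive.

Import GRing.Theory.
Local Open Scope ring_scope.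
Local Open Scope quotient_scope.

(* Submodules of M are the library's [submodClosed M], i.e. boolean predicates.
   As [boolp] turns every Prop-valued predicate into a boolean one, these are
   all the submodules, not only the decidable ones.                          *)

Definition submodule (R : nzRingType) (M : lmodType R) (N : submodClosed M) :=
  {x : M | x \in N}.

Section Submodule.
Variables (R : nzRingType) (M : lmodType R) (N : submodClosed M).
HB.instance Definition _ := [isSub of submodule N for @sval M (fun x => x \in N)].
HB.instance Definition _ := [Choice of submodule N by <:].
HB.instance Definition _ := [SubChoice_isSubLmodule of submodule N by <:].
End Submodule.

(* The library does not derive [zmodClosed] from [submodClosed] (which also
   makes sense over semirings), but quotients are built from [zmodClosed].   *)
Definition zmod_of_submod (R : nzRingType) (M : lmodType R)
  (N : submodClosed M) : {pred M} := fun x => x \in N.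

Lemma zmod_of_submod_closed (R : nzRingType) (M : lmodType R)
  (N : submodClosed M) : zmod_closed (zmod_of_submod N).
Proof.
split=> [|x y xN yN]; first exact: rpred0.
by apply: rpredD => //; rewrite -scaleN1r; apply: rpredZ.
Qed.

HB.instance Definition _ (R : nzRingType) (M : lmodType R)
  (N : submodClosed M) :=
  GRing.isZmodClosed.Build M (zmod_of_submod N) (zmod_of_submod_closed N).

Definition quotmod (R : nzRingType) (M : lmodType R) (N : submodClosed M) :=
  Quotient.quot (zmod_of_submod N).

Section QuotientModule.
Variables (R : nzRingType) (M : lmodType R) (N : submodClosed M).
Local Notation Q := (quotmod N).

HB.instance Definition _ := GRing.Zmodule.on Q.
HB.instance Definition _ := EqQuotient.on Q.

Definition quotmod_scale (a : R) (x : Q) : Q := \pi_Q (a *: repr x).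

Lemma pi_addE (x y : M) : \pi_Q (x + y) = \pi_Q x + \pi_Q y.
Proof. exact: (@Quotient.pi_add M (zmod_of_submod N)). Qed.

Lemma quotmod_scaleE a (x : M) : quotmod_scale a (\pi_Q x) = \pi_Q (a *: x).
Proof.
apply/eqP; rewrite -Quotient.idealrBE -scalerBr.
apply: (@rpredZ R M N); change (repr (\pi_Q x) - x \in zmod_of_submod N).
by rewrite Quotient.idealrBE reprK.
Qed.

Lemma quotmod_scaleA a b x :
  quotmod_scale a (quotmod_scale b x) = quotmod_scale (a * b) x.
Proof.
by elim/quotW: x => x; rewrite (quotmod_scaleE b) !quotmod_scaleE scalerA.
Qed.

Lemma quotmod_scale1 : left_id 1 quotmod_scale.
Proof. by elim/quotW=> x; rewrite quotmod_scaleE scale1r. Qed.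

Lemma quotmod_scaleDr : right_distributive quotmod_scale +%R.
Proof.
move=> a; elim/quotW=> x; elim/quotW=> y.
by rewrite -pi_addE !quotmod_scaleE scalerDr pi_addE.
Qed.

Lemma quotmod_scaleDl x : {morph quotmod_scale^~ x : a b / a + b}.
Proof.
by move=> a b; elim/quotW: x => x; rewrite !quotmod_scaleE scalerDl pi_addE.
Qed.

HB.instance Definition _ := GRing.Zmodule_isLmodule.Build R Q
  quotmod_scaleA quotmod_scale1 quotmod_scaleDr quotmod_scaleDl.
End QuotientModule.

Definition divides (R : comNzRingType) (a b : R) : Prop := exists c, b = a * c.

Definition prime_elt (R : idomainType) (p : R) : Prop :=
  [/\ p != 0, p \isn't a GRing.unit &
      forall a b, divides p (a * b) -> divides p a \/ divides p b].

(* The ideal aR, as a submodule of R^o; it may be the unit ideal, which the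
   library's [idealr] excludes.                                              *)
Definition principal (R : comNzRingType) (a : R) : {pred R^o} :=
  fun x => `[< divides a x >].

Lemma principal_submod (R : comNzRingType) (a : R) :
  submod_closed (principal a).
Proof.
split=> [|c x y]; first by apply/asboolP; exists 0; rewrite mulr0.
move=> /asboolP[u ->] /asboolP[v ->]; apply/asboolP; exists (c * u + v).
by rewrite mulrDr mulrCA.
Qed.

HB.instance Definition _ (R : comNzRingType) (a : R) :=
  GRing.isSubmodClosed.Build R R^o (principal a) (principal_submod a).

Definition cyclic_quot (R : comNzRingType) (a : R) := quotmod (principal a).
HB.instance Definition _ (R : comNzRingType) (a : R) :=
  GRing.Lmodule.on (cyclic_quot a).

Definition is_PID (R : idomainType) : Prop :=
  forall I : submodClosed R^o, exists a : R, I =i principal a.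

Definition fin_gen (R : nzRingType) (M : lmodType R) : Prop :=
  exists (m : nat) (g : 'I_m -> M),
    forall x : M, exists c : 'I_m -> R, x = \sum_(i < m) c i *: g i.

Definition embeds (R : nzRingType) (M N : lmodType R) : Prop :=
  exists f : {linear M -> N}, injective f.

Definition lmod_iso (R : nzRingType) (M N : lmodType R) : Prop :=
  exists f : {linear M -> N}, bijective f.

Definition weakly_uniserial (R : nzRingType) (M : lmodType R) : Prop :=
  forall N K : submodClosed M,
    embeds (submodule N) (submodule K) \/ embeds (submodule K) (submodule N).

(* Main.v *)
(* A relation among generators can be rewritten by Bezout changes of generators
   as d h = 0 for a single new generator h.  Hence if every nonzero element of a
   finitely generated module has the same annihilator aR, a minimal generating
   family is a basis over R/aR; this covers torsion-free modules (a = 0) and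
   vector spaces over R/pR at once.  The property passes to submodules, which are
   again finitely generated, and of two submodules the one with the shorter basis
   embeds into the other.  The submodules of R/p^n form a chain.

   Conversely, comparing lines shows that a weakly uniserial M is torsion-free or
   torsion, and that in the torsion case a single prime p occurs, so that
   p^k M = 0 for some least k.  If k = 1, M is a vector space over R/pR.
   Otherwise pick x with y = p^(k-1) x nonzero.  For z in the p-torsion of M, the
   line Rx and the plane Ry + Rz are comparable only if z lies in Ry; subtracting
   multiples of x then lowers the exponent of any element of M until it vanishes,
   whence M = Rx. *)
From HB Require Import structures.
Require Import Defs.
From mathcomp Require Import all_boot all_algebra.
From mathcomp Require Import boolp ring.

Set Implicit Arguments.
Unset Strict Implicit.
Unset Printing Implicit Defensive.

Import GRing.Theory.
Local Open Scope ring_scope.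

(** * Submodules as [Prop]-valued predicates; combinations, lines and planes *)

Section PropSubmodules.
Variables (R : nzRingType) (M : lmodType R).

Definition closedP (P : M -> Prop) :=
  P 0 /\ forall a x y, P x -> P y -> P (a *: x + y).

Definition sub_of (P : M -> Prop) (cP : closedP P) : {pred M} := fun x => `[< P x >].

Lemma sub_of_closed P (cP : closedP P) : submod_closed (sub_of cP).
Proof.
case: (cP) => P0 PD; split=> [|a x y]; first exact/asboolP.
by move=> /asboolP Px /asboolP Py; apply/asboolP; apply: PD.
Qed.

HB.instance Definition _ P (cP : closedP P) :=
  GRing.isSubmodClosed.Build R M (sub_of cP) (sub_of_closed cP).

(** An injective linear map from P to Q, kept as a total function on M so that no subtype elements
    have to be handled; its values outside P are irrelevant. *)
Definition embeds_pred (P Q : M -> Prop) := exists f : M -> M,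
  [/\ forall x, P x -> Q (f x),
      forall x y, P x -> P y -> f (x + y) = f x + f y,
      forall a x, P x -> f (a *: x) = a *: f x &
      forall x, P x -> f x = 0 -> x = 0].

Lemma weakly_uniserial_pred (P Q : M -> Prop) :
    weakly_uniserial M -> closedP P -> closedP Q ->
  embeds_pred P Q \/ embeds_pred Q P.
Proof.
move=> wu cP cQ.
suff emb P' Q' (cP' : closedP P') (cQ' : closedP Q') :
    embeds (submodule (sub_of cP')) (submodule (sub_of cQ')) ->
    embeds_pred P' Q'.
  by case: (wu (sub_of cP) (sub_of cQ)) => /emb; [left | right].
case=> f f_inj.
have PS x : P' x -> x \in sub_of cP' by move=> ?; apply/asboolP.
have [P0 PD] := cP'.
have PZ a x : P' x -> P' (a *: x) by move=> Px; rewrite -[_ *: _]addr0; apply: PD.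
exists (fun x => val (f (insubd 0 x))); split=> [x Px|x y Px Py|a x Px|x Px].
- exact/asboolP/(valP (f _)).
- have -> : insubd 0 (x + y) = insubd 0 x + insubd 0 y :> submodule (sub_of cP').
    apply: val_inj; rewrite [RHS]raddfD /= !val_insubd !PS //.
    by rewrite -[x]scale1r; apply: PD.
  by rewrite !raddfD.
- have -> : insubd 0 (a *: x) = a *: insubd 0 x :> submodule (sub_of cP').
    by apply: val_inj; rewrite [RHS]linearZ /= !val_insubd !PS //; apply: PZ.
  by rewrite !linearZ.
- move=> f0; have : insubd 0 x = 0 :> submodule (sub_of cP').
    by apply: f_inj; apply: val_inj; rewrite f0 !raddf0.
  by move/(congr1 val); rewrite val_insubd PS // raddf0.
Qed.

(** Families are indexed by [nat], with only the first k entries counting, so that tails can be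
    taken and k changed without casts. *)
Definition comb (k : nat) (c : nat -> R) (g : nat -> M) := \sum_(i < k) c i *: g i.

Definition spans k (g : nat -> M) := forall x, exists c, x = comb k c g.

Lemma comb0 c g : comb 0 c g = 0. Proof. exact: big_ord0. Qed.

Lemma combS k c g :
  comb k.+1 c g = c 0%N *: g 0%N + comb k (fun i => c i.+1) (fun i => g i.+1).
Proof. exact: big_ord_recl. Qed.

Lemma comb_linear k a c e g :
  a *: comb k c g + comb k e g = comb k (fun i => a * c i + e i) g.
Proof.
rewrite /comb scaler_sumr -big_split; apply: eq_bigr => i _ /=.
by rewrite scalerDl scalerA.
Qed.

Lemma fin_gen_spans : fin_gen M -> exists k g, spans k g.
Proof.
case=> m [g gP]; exists m, (fun i => oapp g 0 (insub i)) => x.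
have [c ->] := gP x; exists (fun i => oapp c 0 (insub i)).
by apply: eq_bigr => i _; rewrite !valK.
Qed.

Definition line (x z : M) := exists r, z = r *: x.

Lemma line_closed x : closedP (line x).
Proof.
split=> [|a _ _ [r ->] [s ->]]; first by exists 0; rewrite scale0r.
by exists (a * r + s); rewrite scalerDl scalerA.
Qed.

Lemma line_id x : line x x. Proof. by exists 1; rewrite scale1r. Qed.

Definition plane (x y z : M) := exists r s, z = r *: x + s *: y.

Lemma plane_closed x y : closedP (plane x y).
Proof.
split=> [|a _ _ [r [s ->]] [r' [s' ->]]].
  by exists 0, 0; rewrite !scale0r addr0.
exists (a * r + r'), (a * s + s').
by rewrite !scalerDl !scalerDr !scalerA addrACA.
Qed.

End PropSubmodules.

(** * Linear maps determined by relations among generators *)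

Section Transfer.
Variables (R : nzRingType) (A B : lmodType R) (k : nat) (s : nat -> A) (t : nat -> B).
Hypothesis s_spans : spans k s.
Hypothesis st : forall c, comb k c s = 0 <-> comb k c t = 0.

(** Sending a combination of [s] to the same combination of [t] is well defined because relations of
    [s] hold for [t], and injective by the converse. *)
Lemma transfer : exists f : {linear A -> B},
  injective f /\ forall c, f (comb k c s) = comb k c t.
Proof.
have [c cP] := choice s_spans.
have stE e e' : comb k e s = comb k e' s <-> comb k e t = comb k e' t.
  have eqE (N : lmodType R) (g : nat -> N) :
      comb k e g = comb k e' g <-> comb k (fun i => -1 * e' i + e i) g = 0.
    rewrite -comb_linear scaleN1r addrC; split=> [->|/eqP]; first by rewrite subrr.
    by rewrite subr_eq0 => /eqP.
  by split=> /eqE/st/eqE.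
pose f x := comb k (c x) t.
have flin : linear f.
  by move=> a x y; rewrite /f comb_linear; apply/stE; rewrite -comb_linear -!cP.
pose F : {linear A -> B} := HB.pack f (GRing.isLinear.Build R A B _ f flin).
exists F; split=> [x y /stE|e]; first by rewrite -!cP.
by apply/stE; rewrite -cP.
Qed.

Lemma transfer_embeds : embeds A B.
Proof. by have [f [f_inj _]] := transfer; exists f. Qed.

Lemma transfer_iso : spans k t -> lmod_iso A B.
Proof.
move=> /choice[c cP]; have [f [f_inj fE]] := transfer; exists f.
have fK : cancel (fun y => comb k (c y) s) f by move=> y; rewrite fE -cP.
by exists (fun y => comb k (c y) s) => // x; apply: f_inj; rewrite fK.
Qed.

End Transfer.

(** * Divisibility, Bezout identities and primes in a principal ideal domain *)

Section PID.
Variable R : idomainType.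
Hypothesis pidR : is_PID R.

Lemma pid_pred (P : R -> Prop) :
    P 0 -> (forall a x y, P x -> P y -> P (a * x + y)) ->
  exists a, forall x, P x <-> divides a x.
Proof.
move=> P0 PD; have cP : closedP (P : R^o -> Prop) by [].
have [a aP] := pidR (sub_of cP); exists a => x.
have := aP x; rewrite -!topredE /= => xE.
by split=> /asboolP; [rewrite -[X in is_true X]/(sub_of cP x) xE|
  rewrite -[X in is_true X]/(principal a x) -xE] => /asboolP.
Qed.

(** The identity concerns the cofactors, so that the matrix with rows (a', b') and (-v, u) has
    determinant 1 even if a = b = 0; [comb_reduce] changes generators by it. *)
Lemma bezout (a b : R) :
  exists d a' b' u v, [/\ a = d * a', b = d * b' & u * a' + v * b' = 1].
Proof.
have [|c x y [u [v ->]] [u' [v' ->]]|d dP] :=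
    @pid_pred (fun x => exists u v, x = u * a + v * b).
- by exists 0, 0; rewrite !mul0r addr0.
- by exists (c * u + u'), (c * v + v'); ring.
have [|a' aE] := (dP a).1; first by exists 1, 0; ring.
have [|b' bE] := (dP b).1; first by exists 0, 1; ring.
have [|u [v dE]] := (dP d).2; first by exists 1; rewrite mulr1.
have [d0|d0] := eqVneq d 0.
  (* Here a = b = 0 and d cannot be cancelled, so coprime cofactors are chosen by hand. *)
  by exists 0, 1, 0, 1, 0; rewrite aE bE d0; split; ring.
exists d, a', b', u, v; split=> //; apply: (mulfI d0).
by rewrite mulr1 [RHS]dE aE bE; ring.
Qed.

(** Let d be the gcd of r and p = d p'. Either p divides d, hence r, or p divides p' and d is a
    unit. *)
Lemma prime_coprime (p r : R) : prime_elt p -> ~ divides p r ->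
  exists u v, u * r + v * p = 1.
Proof.
move=> [p0 pU pP] pr; have [d [r' [p' [u [v [rE pE uv]]]]]] := bezout r p.
have [[x xE]|[x xE]] : divides p d \/ divides p p'.
- by apply: pP; exists 1; rewrite -pE mulr1.
- by case: pr; exists (x * r'); rewrite mulrA -xE.
have dx : d * x = 1.
  by apply: (mulfI p0); rewrite mulr1 [RHS]pE xE; ring.
exists (u * x), (v * x); rewrite rE pE.
transitivity (d * x * (u * r' + v * p')); first ring.
by rewrite uv dx mulr1.
Qed.

Lemma prime_coprimeX (p r : R) n : prime_elt p -> ~ divides p r ->
  exists u v, u * r + v * p ^+ n = 1.
Proof.
move=> pP pr; have [u [v uv]] := prime_coprime pP pr.
elim: n => [|n [u' [v' uv']]]; first by exists 0, 1; ring.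
(* Coefficients of the product of the two Bezout identities. *)
exists (u' * u * r + u' * v * p + u * v' * p ^+ n), (v * v').
transitivity ((u * r + v * p) * (u' * r + v' * p ^+ n)); last by rewrite uv uv' mulr1.
by rewrite exprS; ring.
Qed.

(* Modulo p^n, r and p^i generate the same ideal. *)
Lemma valuation (p r : R) n : prime_elt p ->
  exists i s t v, r = s * p ^+ i /\ p ^+ i = t * r + v * p ^+ n.
Proof.
move=> pP; elim: n r => [|n IHn] r; first by exists 0%N, r, 0, 1; split; ring.
have [[r' ->]|pr] := pselect (divides p r).
  have [i [s [t [v [rE piE]]]]] := IHn r'.
  exists i.+1, s, t, v; rewrite !exprS piE; split; last ring.
  by rewrite {1}rE; rewrite -piE; ring.
(* If p does not divide r, then r is invertible modulo p^(n+1), and i = 0. *)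
have [u [v uv]] := prime_coprimeX n.+1 pP pr.
by exists 0%N, r, u, v; rewrite uv expr0 mulr1.
Qed.

(** Induction along proper divisors. A counterexample starts an endless sequence of proper divisors;
    the union of the ideals they generate is principal, and its generator already lies in one of
    them, so the sequence cannot go on. *)
Lemma pid_dvd_ind (P : R -> Prop) :
    (forall d, d != 0 ->
      (forall e, e != 0 -> divides e d -> ~ divides d e -> P e) -> P d) ->
  forall d, d != 0 -> P d.
Proof.
move=> PI d0 d0N0; apply: contrapT => nPd0.
pose S := {d : R | d != 0 /\ ~ P d}.
have next (d : S) : exists e : S,
    divides (sval e) (sval d) /\ ~ divides (sval d) (sval e).
  case: d => d [dN0 nPd] /=; apply: contrapT => noe; apply: nPd.
  apply: PI => // e eN0 ed nde; apply: contrapT => nPe; apply: noe.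
  by exists (exist _ e (conj eN0 nPe)).
have [f fP] := choice next.
pose u n := sval (iter n f (exist _ d0 (conj d0N0 nPd0))).
have uS n : divides (u n.+1) (u n) /\ ~ divides (u n) (u n.+1) by exact: fP.
have u_le m n : (m <= n)%N -> divides (u n) (u m).
  move/subnK<-; elim: (n - m)%N => [|j [x IHj]]; first by exists 1; rewrite mulr1.
  by rewrite addSn; have [[y yE] _] := uS (j + m)%N; exists (y * x); rewrite mulrA -yE.
have [|a x y [m [z ->]] [n [w ->]]|a aP] :=
    @pid_pred (fun x => exists n, divides (u n) x).
- by exists 0%N, 0; rewrite mulr0.
- have [i iE] := u_le _ _ (leq_maxl m n); have [j jE] := u_le _ _ (leq_maxr m n).
  by exists (maxn m n), (a * i * z + j * w); rewrite iE jE; ring.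
have [n [x xE]] : exists n, divides (u n) a by apply/aP; exists 1; rewrite mulr1.
have [y yE] : divides a (u n.+1) by apply/aP; exists n.+1, 1; rewrite mulr1.
by case: (uS n) => _; case; exists (x * y); rewrite mulrA -xE.
Qed.

(** If d is not prime, it divides some ab but neither a nor b. The gcd e of d and a is then a proper
    divisor of d, and not a unit, since otherwise d would divide b. *)
Lemma exists_prime_divisor (d : R) : d != 0 -> d \isn't a GRing.unit ->
  exists2 p, prime_elt p & divides p d.
Proof.
move: d; apply: pid_dvd_ind => d d0 IHd dU.
have [pd|npd] := pselect (prime_elt d); first by exists d => //; exists 1; rewrite mulr1.
have [a [b [[z abE] da db]]] :
    exists a b, [/\ divides d (a * b), ~ divides d a & ~ divides d b].
  apply: contrapT => nab; apply: npd; split=> // a b dab.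
  apply: contrapT => /not_orP[da db]; apply: nab; by exists a, b.
have [e [d' [a' [u [v [dE aE uv]]]]]] := bezout d a.
have [||||p pP [w wE]] := IHd e; last 1 first.
- by exists p => //; exists (w * d'); rewrite mulrA -wE.
- by apply: contraNneq d0 => e0; rewrite dE e0 mul0r.
- by exists d'.
- by case=> w wE; apply: da; exists (w * a'); rewrite mulrA -wE.
apply/negP => eU; apply: db; exists (e^-1 * (u * b + v * z)).
apply: (mulrI eU); transitivity (b * (e * (u * d' + v * a'))); first by rewrite uv; ring.
transitivity (u * b * (e * d') + v * (a * b)); first by rewrite aE; ring.
by rewrite abE -dE [RHS]mulrCA (mulVKr eU); ring.
Qed.

(* Torsion-freeness for a = 0; an R/aR-vector space structure for a prime. *)
Definition annihilated_by (M : lmodType R) (a : R) :=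
  forall r (x : M), r *: x = 0 <-> x = 0 \/ divides a r.

(** * Generators of submodules, and bases relative to a common annihilator *)

Section Modules.
Variable M : lmodType R.

(** The possible coefficients on [g 0] of elements of P form an ideal dR. An element y of P
    realizing d is one generator; subtracting a multiple of y leaves an element of P in the span of
    the tail. As the tail need not span M, only elements of P in the span of [g] are treated. *)
Lemma sub_span (P : M -> Prop) k g : closedP P ->
  exists l h, (forall i, P (h i)) /\
    forall x, P x -> (exists c, x = comb k c g) -> exists c, x = comb l c h.
Proof.
move=> cP; have [P0 PD] := cP; elim: k g => [|k IHk] g.
  exists 0%N, (fun=> 0); split=> // x _ [c ->].
  by exists c; rewrite !comb0.
have [|a x y [c xP] [e yP]|d dP] := @pid_pred
    (fun r => exists c, P (r *: g 0%N + comb k c (fun i => g i.+1))).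
- exists (fun=> 0); rewrite scale0r add0r /comb big1 // => i _.
  by rewrite scale0r.
- exists (fun i => a * c i + e i).
  have := PD a _ _ xP yP.
  by rewrite scalerDr addrACA comb_linear scalerA -scalerDl.
have [|c0 yP] := (dP d).2; first by exists 1; rewrite mulr1.
set y := (X in P X) in yP.
have [l [h [hP lhP]]] := IHk (fun i => g i.+1).
exists l.+1, (fun i => if i is j.+1 then h j else y); split=> [[]//|x Px [c xE]].
have [|e cE] := (dP (c 0%N)).1.
  by exists (fun i => c i.+1); rewrite -combS -xE.
have [||b bE] := lhP (- e *: y + x).
- exact: PD.
- exists (fun i => - e * c0 i + c i.+1).
  rewrite xE combS -comb_linear /y scalerDr scalerA cE mulNr mulrC addrACA scaleNr.
  by rewrite addNr add0r.
exists (fun i => if i is j.+1 then b j else e).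
by rewrite combS /= -bE scaleNr addNKr.
Qed.

Lemma submodule_spans (N : submodClosed M) k (g : nat -> M) : spans k g ->
  exists l (h : nat -> submodule N), spans l h.
Proof.
move=> gP; have [|l [h [hN lhP]]] := @sub_span (fun x => x \in N) k g.
  by split=> [|a x y xN yN]; [exact: rpred0 | rewrite rpredD ?rpredZ].
exists l, (fun i => exist _ (h i) (hN i)) => x.
have [|c cE] := lhP (val x) (valP x); first exact: gP.
exists c; apply: val_inj; rewrite cE /comb raddf_sum; apply: eq_bigr => i _.
by rewrite [RHS]linearZ.
Qed.

(* Bezout changes of generators gather the whole combination on h 0, with the
   gcd of the coefficients as new coefficient. *)
Lemma comb_reduce k (c : nat -> R) (g : nat -> M) :
  exists d h, [/\ comb k.+1 c g = d *: h 0%N,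
    forall i, (i < k.+1)%N -> divides d (c i) &
    forall e, exists e', comb k.+1 e g = comb k.+1 e' h].
Proof.
elim: k c g => [|k IHk] c g.
  exists (c 0%N), g; split=> [|[|i]//|e]; last by exists e.
  - by rewrite combS comb0 addr0.
  - by exists 1; rewrite mulr1.
have [d' [h' [h'E d'P h'P]]] := IHk (fun i => c i.+1) (fun i => g i.+1).
have [d [a [b [u [v [cE d'E uv]]]]]] := bezout (c 0%N) d'.
(* A change of generators of determinant ua + vb = 1; [g0E] and [h'0E] invert it. *)
pose h0 := a *: g 0%N + b *: h' 0%N; pose h1 := - v *: g 0%N + u *: h' 0%N.
have g0E : g 0%N = u *: h0 - b *: h1.
  rewrite /h0 /h1 !scalerDr !scalerA opprD -!scaleNr addrACA -!scalerDl.
  rewrite [X in X *: g 0%N](_ : _ = u * a + v * b); last ring.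
  by rewrite uv scale1r [X in X *: h' _](_ : _ = 0) ?scale0r ?addr0 //; ring.
have h'0E : h' 0%N = v *: h0 + a *: h1.
  rewrite /h0 /h1 !scalerDr !scalerA addrACA -!scalerDl.
  rewrite [X in _ + X *: _](_ : _ = u * a + v * b); last ring.
  by rewrite uv scale1r [X in X *: g _](_ : _ = 0) ?scale0r ?add0r //; ring.
exists d, (fun i => if i is j.+1 then if j is l.+1 then h' l.+1 else h1 else h0).
split=> [|[|i] ik|e].
- by rewrite combS h'E cE d'E -!scalerA -scalerDr.
- by exists a.
- by have [w ->] := d'P i ik; exists (b * w); rewrite d'E mulrA.
have [e' eE] := h'P (fun i => e i.+1).
exists (fun i => if i is j.+1 then
    if j is l.+1 then e' l.+1 else a * e' 0%N - b * e 0%N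
  else u * e 0%N + v * e' 0%N).
rewrite combS eE !combS /= addrA addrA; congr (_ + _).
clearbody h0 h1; rewrite g0E h'0E !scalerDr addrACA !scalerN -!scaleNr !scalerA -!scalerDl.
by congr (_ *: _ + _ *: _); ring.
Qed.

Lemma exists_basis a k (g : nat -> M) : annihilated_by M a -> spans k g ->
  exists l (h : nat -> M), spans l h /\
    forall c, comb l c h = 0 <-> forall i, (i < l)%N -> divides a (c i).
Proof.
move=> aM; elim: k g => [|k IHk] g gP.
  by exists 0%N, g; split=> // c; split=> // _; rewrite comb0.
have [[c [i [c0 ik aci]]]|indep] := pselect (exists c i,
    [/\ comb k.+1 c g = 0, (i < k.+1)%N & ~ divides a (c i)]); last first.
  exists k.+1, g; split=> // c; split=> [c0 i ik|cP].
    by apply: contrapT => aci; apply: indep; exists c, i.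
  by rewrite /comb big1 // => i _; apply/aM; right; apply: cP.
have [d [h [cE dP hP]]] := comb_reduce k c g.
(* Since d divides c i and a does not, a cannot divide d; hence h 0 = 0 and this generator is
   dropped. *)
have /aM[h0|[w wE]] : d *: h 0%N = 0 by rewrite -cE.
  apply: (IHk (fun i => h i.+1)) => x; have [e ->] := gP x.
  have [e' ->] := hP e; exists (fun i => e' i.+1).
  by rewrite combS h0 scaler0 add0r.
by case: aci; have [z ->] := dP i ik; exists (w * z); rewrite wE mulrA.
Qed.

End Modules.

(** * Modules whose nonzero elements share one annihilator *)

Lemma annihilated_by_inj (A B : lmodType R) (f : {linear A -> B}) a :
  injective f -> annihilated_by B a -> annihilated_by A a.
Proof.
move=> f_inj aB r x; have f0 y : y = 0 <-> f y = 0.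
  by split=> [->|]; [exact: raddf0 | rewrite -[X in _ = X](raddf0 f) => /f_inj].
by rewrite f0 linearZ (f0 x); exact: aB.
Qed.

Lemma annihilated_by_embeds (A B : lmodType R) a k l (g : nat -> A) (h : nat -> B) :
    annihilated_by A a -> annihilated_by B a -> spans k g -> spans l h ->
  embeds A B \/ embeds B A.
Proof.
move=> aA aB gP hP.
have [k' [s [sP sE]]] := exists_basis aA gP.
have [l' [t [tP tE]]] := exists_basis aB hP.
have emb (A' B' : lmodType R) (s' : nat -> A') (t' : nat -> B') m n :
    (m <= n)%N -> spans m s' ->
    (forall c, comb m c s' = 0 <-> forall i, (i < m)%N -> divides a (c i)) ->
    (forall c, comb n c t' = 0 <-> forall i, (i < n)%N -> divides a (c i)) ->
    embeds A' B'.
  move=> mn s'P s'E t'E; apply: (transfer_embeds (t := t') s'P) => c.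
  (* Padding with zero coefficients: the shorter basis goes to the first m vectors of the longer
     one. *)
  have -> : comb m c t' = comb n (fun i => if (i < m)%N then c i else 0) t'.
    rewrite /comb (big_ord_widen _ (fun i => c i *: t' i) mn) big_mkcond.
    by apply: eq_bigr => i _; case: ifP; rewrite ?scale0r.
  rewrite s'E t'E; split=> cP i ilt; last first.
    by have := cP i (leq_trans ilt mn); rewrite ilt.
  by case: ifP => [/cP//|_]; exists 0; rewrite mulr0.
have [kl|/ltnW lk] := leqP k' l'; first by left; apply: emb kl sP sE tE.
by right; apply: emb lk tP tE sE.
Qed.

Lemma annihilated_by_weakly_uniserial (M : lmodType R) a : fin_gen M -> annihilated_by M a ->
  weakly_uniserial M.
Proof.
move=> /fin_gen_spans[k [g gP]] aM N K.
have [l [h hP]] := submodule_spans N gP.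
have [l' [h' h'P]] := submodule_spans K gP.
have aS (S : submodClosed M) : annihilated_by (submodule S) a.
  pose f : {linear submodule S -> M} := val.
  by apply: (annihilated_by_inj (f := f)) => //; exact: val_inj.
exact: (annihilated_by_embeds (aS N) (aS K) hP h'P).
Qed.

(** * The modules R/aR, sums of copies of R/pR, and free modules *)

(** Later proofs know R/aR only through this generator, the class of 1. *)
Lemma cyclic_quot_gen (a : R) : exists e : cyclic_quot a,
  (forall r, r *: e = 0 <-> divides a r) /\ forall x, exists r, x = r *: e.
Proof.
pose pi (x : R^o) : cyclic_quot a := (\pi_(quotmod (principal a)) x)%qT.
have piZ r (x : R^o) : r *: pi x = pi (r *: x) by exact: quotmod_scaleE.
exists (pi 1); split=> [r|]; last first.
  move=> x; exists (repr x : R^o); rewrite piZ /GRing.scale /= mulr1.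
  by rewrite /pi reprK.
rewrite piZ /GRing.scale /= mulr1.
have -> : (0 : cyclic_quot a) = pi 0 by rewrite -(scale0r (pi 0)) piZ scaler0.
split=> [/eqP|ar].
  by rewrite -Quotient.idealrBE subr0 => /asboolP.
by apply/eqP; rewrite -Quotient.idealrBE subr0; apply/asboolP.
Qed.

Lemma cyclic_quot_iso (M : lmodType R) (a : R) (x : M) :
    (forall y, exists r, y = r *: x) -> (forall r, r *: x = 0 <-> divides a r) ->
  lmod_iso M (cyclic_quot a).
Proof.
move=> xP xE; have [e [eE eP]] := cyclic_quot_gen a.
apply: (@transfer_iso _ _ _ 1 (fun=> x) (fun=> e)) => [y|c|y].
- by have [r ->] := xP y; exists (fun=> r); rewrite /comb big_ord1.
- by rewrite /comb !big_ord1 xE eE.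
- by have [r ->] := eP y; exists (fun=> r); rewrite /comb big_ord1.
Qed.

Lemma annihilated_by_ffun (p : R) n : prime_elt p ->
  annihilated_by {ffun 'I_n -> cyclic_quot p} p.
Proof.
move=> [p0 pU pP] r x; have [e [eE eP]] := cyclic_quot_gen p.
split=> [rx0|[->|[s ->]]]; last 2 first.
- exact: scaler0.
- apply/ffunP => i; rewrite !ffunE; have [c ->] := eP (x i).
  by rewrite scalerA; apply/eE; exists (s * c); rewrite mulrA.
have [pr|pr] := pselect (divides p r); [by right | left].
apply/ffunP => i; have [c xE] := eP (x i); rewrite !ffunE xE; apply/eE.
have : (r *: x) i = 0 by rewrite rx0 ffunE.
by rewrite ffunE xE scalerA eE => /pP[].
Qed.

Lemma annihilated_by_rV n : annihilated_by 'rV[R]_n 0.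
Proof.
move=> r x; split=> [/eqP|[->|[s ->]]]; last 2 first.
- exact: scaler0.
- by rewrite mul0r scale0r.
rewrite scalemx_eq0 => /orP[]/eqP->; last by left.
by right; exists 0; rewrite mulr0.
Qed.

Lemma torsion_free_iso (M : lmodType R) : fin_gen M -> annihilated_by M 0 ->
  exists n, lmod_iso M 'rV[R]_n.
Proof.
move=> /fin_gen_spans[k [g gP]] /exists_basis/(_ gP)[n [h [hP hE]]].
pose t (i : nat) : 'rV[R]_n := \row_j (i == j :> nat)%:R.
have tE c : comb n c t = \row_(j < n) c j.
  apply/rowP => j; rewrite summxE mxE (bigD1 j) //= !mxE eqxx mulr1 big1 ?addr0 //.
  by move=> i; rewrite -val_eqE !mxE => /negPf->; rewrite mulr0.
exists n; apply: (transfer_iso (t := t) hP) => [c|x]; last first.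
  exists (fun i => oapp (x 0) 0 (insub i)); rewrite tE.
  by apply/rowP => j; rewrite mxE valK.
rewrite hE tE; split=> [cP|/rowP cP i il].
  by apply/rowP => j; rewrite !mxE; have [s ->] := cP j (ltn_ord j); rewrite mul0r.
by have := cP (Ordinal il); rewrite !mxE /= => ->; exists 0; rewrite mulr0.
Qed.

Lemma annihilated_by_prime_iso (M : lmodType R) p :
    fin_gen M -> annihilated_by M p ->
  exists n, lmod_iso M {ffun 'I_n -> cyclic_quot p}.
Proof.
move=> /fin_gen_spans[k [g gP]] /exists_basis/(_ gP)[n [h [hP hE]]].
have [e [eE eP]] := cyclic_quot_gen p.
pose t (i : nat) : {ffun 'I_n -> cyclic_quot p} := [ffun j : 'I_n => (i == j :> nat)%:R *: e].
have tE c : comb n c t = [ffun j : 'I_n => c j *: e].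
  apply/ffunP => j; rewrite sum_ffunE ffunE (bigD1 j) //= !ffunE eqxx scale1r.
  rewrite big1 ?addr0 // => i; rewrite -val_eqE !ffunE => /negPf->.
  by rewrite scale0r scaler0.
exists n; apply: (transfer_iso (t := t) hP) => [c|x]; last first.
  have /choice[c cP] := fun j => eP (x j).
  exists (fun i => oapp c 0 (insub i)); rewrite tE.
  by apply/ffunP => j; rewrite ffunE valK /= -cP.
rewrite hE tE; split=> [cP|/ffunP cP i il].
  by apply/ffunP => j; rewrite !ffunE; apply/eE/cP.
by have := cP (Ordinal il); rewrite !ffunE => /eE.
Qed.

(** By [valuation], each f x spans the same line as some p^i e. Hence any two lines of M are
    comparable, and so are any two submodules. *)
Lemma cyclic_primary_weakly_uniserial (M : lmodType R) p n : prime_elt p ->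
  lmod_iso M (cyclic_quot (p ^+ n)) -> weakly_uniserial M.
Proof.
move=> pP [f /bij_inj f_inj]; have [e [eE eP]] := cyclic_quot_gen (p ^+ n).
have fval x : exists i s t, f x = s *: (p ^+ i *: e) /\ p ^+ i *: e = t *: f x.
  have [r fxE] := eP (f x); have [i [s [t [v [rE pE]]]]] := valuation r n pP.
  exists i, s, t; rewrite fxE !scalerA -rE; split=> //.
  rewrite pE scalerDl [v * _]mulrC.
  by have /eE-> := ex_intro (fun c => p ^+ n * v = p ^+ n * c) v erefl; rewrite addr0.
have chain (x y : M) : line x y \/ line y x.
  have [i [s [t [xE iE]]]] := fval x; have [j [s' [t' [yE jE]]]] := fval y.
  have [ij|/ltnW ji] := leqP i j; [left | right].
    exists (s' * p ^+ (j - i) * t); apply: f_inj; rewrite linearZ /= -scalerA -iE.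
    by rewrite yE !scalerA -mulrA -exprD subnK.
  exists (s * p ^+ (i - j) * t'); apply: f_inj; rewrite linearZ /= -scalerA -jE.
  by rewrite xE !scalerA -mulrA -exprD subnK.
move=> N K.
have incl (A B : submodClosed M) : {subset A <= B} ->
    embeds (submodule A) (submodule B).
  move=> AB; pose h (x : submodule A) : submodule B := exist _ (val x) (AB _ (valP x)).
  have hlin : linear h by move=> a x y; apply: val_inj; rewrite [RHS]linearP -[LHS]/(val (a *: x + y)) linearP.
  pose H : {linear submodule A -> submodule B} :=
    HB.pack h (GRing.isLinear.Build R (submodule A) (submodule B) _ h hlin).
  by exists H => x y /(congr1 val) /= xy; apply: val_inj.
have [NK|] := pselect {subset N <= K}; first by left; apply: incl.
move=> nNK; right; apply: incl => y Ky.
have [x Nx nKx] : exists2 x, x \in N & x \notin K.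
  apply: contrapT => nex; apply: nNK => x Nx; apply: contrapT => /negP nKx.
  by apply: nex; exists x.
case: (chain x y) => [[r ->]|[r xE]]; first exact: rpredZ.
by case/negP: nKx; rewrite xE rpredZ.
Qed.

(** * Weakly uniserial modules with torsion *)

Section TorsionCase.
Variable M : lmodType R.
Hypotheses (fgM : fin_gen M) (wuM : weakly_uniserial M).

(** If Rx embeds into Ry, then r kills x. If Ry embeds into Rx by y -> cx, then rc kills x, and c is
    nonzero because y is. *)
Lemma wu_torsion (y : M) r : y != 0 -> r != 0 -> r *: y = 0 ->
  forall x : M, exists2 s, s != 0 & s *: x = 0.
Proof.
move=> y0 r0 ry x.
case: (weakly_uniserial_pred wuM (line_closed x) (line_closed y)).
- case=> f [fP _ fZ f0]; exists r => //; have [c fx] := fP x (line_id x).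
  apply: f0; first by exists r.
  by rewrite fZ ?fx ?scalerA 1?mulrC -?scalerA ?ry ?scaler0 //; apply: line_id.
- case=> f [fP _ fZ f0]; have yy := line_id y; have [c fy] := fP y yy.
  exists (r * c).
    rewrite mulf_neq0 //; apply: contraNneq y0 => c0.
    by apply/eqP/f0; [exact: line_id | rewrite fy c0 scale0r].
  by rewrite -scalerA -fy -fZ // ry -[X in f X](scale0r y) fZ // scale0r.
Qed.

Lemma wu_exponent (y : M) r : y != 0 -> r != 0 -> r *: y = 0 ->
  exists2 e, e != 0 & forall x : M, e *: x = 0.
Proof.
move=> y0 r0 ry; have /fin_gen_spans[k [g gP]] := fgM.
have tors i : exists s, s != 0 /\ s *: g i = 0.
  by have [s s0 sg] := wu_torsion y0 r0 ry (g i); exists s.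
have [s sP] := choice tors; exists (\prod_(i < k) s i).
  by apply/prodf_neq0 => i _; case: (sP i).
move=> x; have [c ->] := gP x; rewrite /comb scaler_sumr big1 // => i _.
rewrite (bigD1 i) //= scalerA -mulrA mulrC -scalerA.
by case: (sP i) => _ ->; rewrite scaler0.
Qed.

(* One of the lines Ry, Rz embeds into the other, whence a nonzero vector killed
   by both p and q. *)
Lemma wu_prime_unique p q (y z : M) : prime_elt p -> y != 0 -> z != 0 ->
  p *: y = 0 -> q *: z = 0 -> divides p q.
Proof.
move=> pP y0 z0 py qz; apply: contrapT => /(prime_coprime pP)[u [v uv]].
have kill (x : M) : q *: x = 0 -> p *: x = 0 -> x = 0.
  move=> qx px; rewrite -[x]scale1r -uv scalerDl -!scalerA qx px.
  by rewrite !scaler0 addr0.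
have emb (a b : R) (s t : M) : s != 0 -> a *: s = 0 -> b *: t = 0 ->
    embeds_pred (line s) (line t) ->
    exists w : M, [/\ w != 0, a *: w = 0 & b *: w = 0].
  move=> s0 as0 bt [f [fP _ fZ f0]]; have ss := line_id s.
  have [c fs] := fP s ss; exists (f s); split.
  - by apply: contra_neq s0 => /f0->.
  - by rewrite -fZ // as0 -[X in f X](scale0r s) fZ // scale0r.
  - by rewrite fs scalerA mulrC -scalerA bt scaler0.
case: (weakly_uniserial_pred wuM (line_closed y) (line_closed z)).
  by case/(emb _ _ _ _ y0 py qz) => w [/eqP w0 pw qw]; apply: w0; apply: kill.
by case/(emb _ _ _ _ z0 qz py) => w [/eqP w0 qw pw]; apply: w0; apply: kill.
Qed.

(** The annihilator of M is eR with e nonzero. Each prime divisor of e kills a nonzero vector, so p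
    divides all of them by [wu_prime_unique]; peeling them off one by one shows that e divides a
    power of p. *)
Lemma wu_primary (y : M) r : y != 0 -> r != 0 -> r *: y = 0 ->
  exists p n, prime_elt p /\ forall x : M, p ^+ n *: x = 0.
Proof.
move=> y0 r0 ry; have [b b0 bM] := wu_exponent y0 r0 ry.
have [|c u v cu cv x|e eP] := @pid_pred (fun s => forall x : M, s *: x = 0).
- exact: scale0r.
- by rewrite scalerDl -scalerA cu cv scaler0 addr0.
have eM : forall x : M, e *: x = 0 by apply/eP; exists 1; rewrite mulr1.
have e0 : e != 0 by have [w wE] := (eP b).1 bM; apply: contraNneq b0 => e0; rewrite wE e0 mul0r.
have tors q : prime_elt q -> divides q e -> exists2 z : M, z != 0 & q *: z = 0.
  move=> [q0 qU _] [w wE]; apply: contrapT => noz.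
  (* For e = qw, the vectors wx are killed by q. Were they all zero, e would divide w and q would be
     a unit. *)
  have [x xE] : divides e w.
    apply/eP => x; apply: contrapT => wx; apply: noz; exists (w *: x); first exact/eqP.
    by rewrite scalerA -wE eM.
  case/negP: qU; apply/unitrPr; exists x; apply: (mulfI e0).
  by rewrite mulr1 mulrCA -xE -wE.
have eU : e \isn't a GRing.unit.
  by apply: contraNN y0 => eU; rewrite -[y]scale1r -(mulVr eU) -scalerA eM scaler0.
have [p pP pe] := exists_prime_divisor e0 eU.
have [z z0 pz] := tors p pP pe.
have assoc q : prime_elt q -> divides q e -> divides p q.
  by move=> qP qe; have [t t0 qt] := tors q qP qe; apply: wu_prime_unique z0 t0 pz qt.
have divX : forall d, d != 0 -> divides d e -> exists n, divides d (p ^+ n).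
  apply: pid_dvd_ind => d d0 IHd de.
  have [dU|dU] := boolP (d \is a GRing.unit).
    by exists 0%N, d^-1; rewrite mulrV.
  have [q qP [w wE]] := exists_prime_divisor d0 dU.
  have [de' de'E] := de.
  have [|x xE] := assoc q qP; first by exists (w * de'); rewrite mulrA -wE.
  have dE : d = p * (x * w) by rewrite mulrA -xE.
  have xw0 : x * w != 0 by apply: contraNneq d0 => xw0; rewrite dE xw0 mulr0.
  have [||||n [t tE]] := IHd (x * w) => //.
  - by exists p; rewrite mulrC.
  - case=> t tE; case: pP => _ /negP + _; apply; apply/unitrPr; exists t.
    by apply: (mulfI xw0); rewrite mulr1 [RHS]tE dE; ring.
  - by exists (p * de'); rewrite de'E dE; ring.
  by exists n.+1, t; rewrite exprS tE dE; ring.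
have [n [w wE]] := divX e e0 (ex_intro _ 1 (esym (mulr1 e))).
by exists p, n; split=> // x; rewrite wE mulrC -scalerA eM scaler0.
Qed.

(* Rx, of exponent p^(k+2), cannot embed into the plane spanned by y = p^(k+1)x
   and z, of exponent p; so the plane embeds into Rx, whose p-torsion is Ry. *)
Lemma wu_socle p k (x z : M) : prime_elt p -> (forall y : M, p ^+ k.+2 *: y = 0) ->
  p ^+ k.+1 *: x != 0 -> p *: z = 0 -> line (p ^+ k.+1 *: x) z.
Proof.
move=> pP pM y0 pz; set y := p ^+ k.+1 *: x in y0 *.
have py : p *: y = 0 by rewrite scalerA -exprS.
have soc r : p *: (r *: x) = 0 -> line y (r *: x).
  have [i [s [t [v [rE pE]]]]] := valuation r k.+2 pP => prx.
  have pix : p *: (p ^+ i *: x) = 0.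
    rewrite pE scalerDl -(scalerA v) pM scaler0 addr0 -scalerA scalerA mulrC -scalerA prx.
    by rewrite scaler0.
  (* Here rx and p^i x span the same line; p kills it, while p^(k+1) x is nonzero. *)
  have ki : (k.+1 <= i)%N.
    rewrite leqNgt; apply: contra y0 => ik; rewrite /y -(subnK ik) exprD exprS.
    by rewrite -scalerA -(scalerA p) pix scaler0.
  exists (s * p ^+ (i - k.+1)); rewrite /y scalerA -mulrA -exprD subnK //.
  by rewrite -rE.
case: (weakly_uniserial_pred wuM (line_closed x) (plane_closed y z)).
  (* Since p kills the plane, f y = p^(k+1) f x vanishes, against injectivity. *)
  case=> f [fP _ fZ f0]; case/eqP: y0; apply: f0; first by exists (p ^+ k.+1).
  have xx := line_id x; rewrite /y fZ //; have [a [b ->]] := fP x xx.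
  rewrite exprSr -scalerA scalerDr ![p *: (_ *: _)]scalerA ![p * _]mulrC.
  by rewrite -!scalerA py pz !scaler0 addr0 scaler0.
case=> f [fP fD fZ f0].
have yy : plane y z y by exists 1, 0; rewrite scale1r scale0r addr0.
have zz : plane y z z by exists 0, 1; rewrite scale1r scale0r add0r.
have fsoc t : plane y z t -> p *: t = 0 -> line y (f t).
  move=> tt pt; have [c ftE] := fP t tt; rewrite ftE; apply: soc.
  by rewrite -ftE -fZ // pt -[X in f X](scale0r z) fZ // scale0r.
have [a fy] := fsoc y yy py; have [b fz] := fsoc z zz pz.
(* As f y = ay is nonzero, p does not divide a, so y = u f y. Then f z = by = f (bu y), and
   injectivity gives z = bu y. *)
have [|u [v uv]] := prime_coprime (r := a) pP.
  case=> c cE; case/eqP: y0; apply: f0 => //.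
  by rewrite fy cE mulrC -scalerA py scaler0.
have yE : y = u *: f y.
  by rewrite fy -[LHS]scale1r -uv scalerDl -!scalerA py scaler0 addr0.
exists (b * u); apply/eqP; rewrite -subr_eq0 addrC -scaleNr; apply/eqP/f0.
  by exists (- (b * u)), 1; rewrite scale1r.
have wy : plane y z (- (b * u) *: y) by exists (- (b * u)), 0; rewrite scale0r addr0.
by rewrite fD // fZ // fz scaleNr -scalerA -yE addNr.
Qed.

Lemma wu_torsion_iso (y : M) r : y != 0 -> r != 0 -> r *: y = 0 ->
  exists (p : R) (n : nat), prime_elt p /\
   (lmod_iso M {ffun 'I_n -> cyclic_quot p} \/ lmod_iso M (cyclic_quot (p ^+ n))).
Proof.
move=> y0 r0 ry; have [p [n0 [pP pn0M]]] := wu_primary y0 r0 ry.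
have ex : exists n, `[< forall x : M, p ^+ n *: x = 0 >] by exists n0; apply/asboolP.
(* Least exponent 0 would make y zero; exponent 1 gives a vector space over R/pR; from 2 on M is
   cyclic. *)
case: (ex_minnP ex) => -[|[|k]] /asboolP pM nmin.
- by case/eqP: y0; rewrite -[y]scale1r pM.
- have [s x|n nP] := annihilated_by_prime_iso (p := p) fgM; last by exists p, n; split; [|left].
  split=> [sx|[->|[t ->]]]; last 2 first.
  + exact: scaler0.
  + by rewrite mulrC -scalerA pM scaler0.
  have [|/(prime_coprime pP)[u [v uv]]] := pselect (divides p s); [by right | left].
  by rewrite -[x]scale1r -uv scalerDl -!scalerA sx pM !scaler0 addr0.
have [x x0] : exists x : M, p ^+ k.+1 *: x != 0.
  apply: contrapT => nox.
  suff /nmin : `[< forall x : M, p ^+ k.+1 *: x = 0 >] by rewrite ltnn.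
  apply/asboolP => x; apply: contrapT => /eqP x0; apply: nox; by exists x.
exists p, k.+2; split=> //; right; apply: (cyclic_quot_iso (x := x)) => [z|s].
  suff gen j (w : M) : (j <= k.+2)%N -> p ^+ j *: w = 0 -> line x w by exact: (gen k.+2).
  elim: j w => [|j IHj] w jk pw.
    by rewrite -[w]scale1r pw; exact: (line_closed x).1.
  have [|c cE] := @wu_socle p k x (p ^+ j *: w) pP pM x0; first by rewrite scalerA -exprS.
  (* As p^j w = c p^(k+1) x by [wu_socle], subtracting c p^(k+1-j) x from w leaves a vector killed
     by p^j. *)
  rewrite -[w](addrNK (c * p ^+ (k.+1 - j) *: x)) addrC -[X in X + _]scale1r.
  have [_ lD] := line_closed x; apply: lD; last first.
  - apply: IHj; first exact: ltnW.
    rewrite scalerBr cE !scalerA mulrCA -exprD subnKC ?subrr //.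
  - by exists (c * p ^+ (k.+1 - j)).
split=> [sx|[t ->]]; last by rewrite mulrC -scalerA pM scaler0.
have [i [a [t [v [sE pE]]]]] := valuation s k.+2 pP.
have pix : p ^+ i *: x = 0.
  by rewrite pE scalerDl -(scalerA v) -(scalerA t) pM sx !scaler0 addr0.
have ki : (k.+2 <= i)%N.
  rewrite leqNgt; apply: contra x0 => ik; rewrite -(subnK (ik : (i <= k.+1)%N)).
  by rewrite exprD -scalerA pix scaler0.
by exists (a * p ^+ (i - k.+2)); rewrite sE mulrCA -exprD subnKC.
Qed.

End TorsionCase.

End PID.

Theorem theorem5p6 (R : idomainType) (M : lmodType R)
    (pidR : is_PID R) (fgM : fin_gen M) :
  weakly_uniserial M <->
  [\/ exists n : nat, lmod_iso M 'rV[R]_n,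
      exists (p : R) (n : nat),
        prime_elt p /\ lmod_iso M {ffun 'I_n -> cyclic_quot p} |
      exists (p : R) (n : nat),
        prime_elt p /\ lmod_iso M (cyclic_quot (p ^+ n))].
Proof.
split=> [wuM|[[n [f /bij_inj f_inj]]|[p [n [pP [f /bij_inj f_inj]]]]|[p [n [pP Mp]]]]].
(* Either some nonzero vector is torsion, or M is torsion-free, that is, [annihilated_by M 0]. *)
- have [[y [r [y0 r0 ry]]]|ntors] := pselect (exists (y : M) r,
      [/\ y != 0, r != 0 & r *: y = 0]).
    have [p [n [pP [?|?]]]] := wu_torsion_iso pidR fgM wuM y0 r0 ry.
    + by apply: Or32; exists p, n.
    + by apply: Or33; exists p, n.
  apply/Or31/torsion_free_iso => // r x; split=> [rx|[->|[s ->]]]; last 2 first.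
  + exact: scaler0.
  + by rewrite mul0r scale0r.
  have [->|x0] := eqVneq x 0; first by left.
  have [->|r0] := eqVneq r 0; first by right; exists 0; rewrite mulr0.
  by case: ntors; exists x, r.
- apply: (annihilated_by_weakly_uniserial pidR fgM (a := 0)).
  by apply: (annihilated_by_inj f_inj); apply: annihilated_by_rV.
- apply: (annihilated_by_weakly_uniserial pidR fgM (a := p)).
  by apply: (annihilated_by_inj f_inj); apply: annihilated_by_ffun.
- exact: cyclic_primary_weakly_uniserial pP Mp.
Qed.
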